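(* Let $M\in\mathrm{pSh}(\Omega,L)$, let $\bar a$ be a tuple of sections of $M$ and let $\alpha$ be an ordinal. Then for any $N\in\mathrm{pSh}(\Omega,L)$ and any $\bar b\in{}^{\mathrm{lh}(\bar a)}|N|$, setting $p=E\bar a\wedge E\bar b$, one has $F^\alpha_{M,\bar a\upharpoonright p}=F^\alpha_{N,\bar b\upharpoonright p}$ if and only if there is a partial isomorphism $h:\bar a\upharpoonright p\to\bar b\upharpoonright p$ (that is, with $h(a_i\upharpoonright p)=b_i\upharpoonright p$ for all $i<\mathrm{lh}(\bar a)$) such that $h\in Q_\alpha(p)$.
   Context: **Presheaves.** Fix a complete Heyting algebra $\Omega$ (top $\top$) and a cardinal $\mu$. A presheaf $M$ over $\Omega$ is a set $|M|$ of sections with maps $E:|M|\to\Omega$ (extent) and $\upharpoonright:|M|\times\Omega\to|M|$ (restriction) such that $a\upharpoonright Ea=a$, $E(a\upharpoonright p)=Ea\wedge p$, $(a\upharpoonright p)\upharpoonright q=a\upharpoonright(p\wedge q)$. Put $[a=b]_M=\bigvee\{p\le Ea\wedge Eb: a\upharpoonright p=b\upharpoonright p\}$; presheaves are extensional: $Ea=Eb=[a=b]_M$ implies $a=b$. For $p\in\Omega$, $|M\upharpoonright p|=\{a\in|M|:Ea\le p\}$. For a tuple $\bar a=\langle a_i:i<\gamma\rangle$ of sections, $\mathrm{lh}(\bar a)=\gamma$, $E\bar a=\bigwedge_iEa_i$ ($E\emptyset=\top$), $\bar a\upharpoonright p=\langle a_i\upharpoonright p\rangle_i$, $[\bar a=\bar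 b]_M=\bigwedge_i[a_i=b_i]_M$. ${}^{\gamma}X$ (${}^{<\mu}X$) is the set of tuples from $X$ of length $\gamma$ (less than $\mu$). **Tuple convention.** Tuples of sections are taken with all entries of the same extent (i.e. $\bar x$ stands for $\bar x\upharpoonright E\bar x$); for $E\bar c\le E\bar a$ the concatenation $\bar a\bar c$ stands for $(\bar a\upharpoonright E\bar c)$ followed by $\bar c$. **Structures.** A signature has finitary relation symbols, finitary function symbols and a presheaf over $\Omega$ of constant symbols (so each constant $c$ has an extent $Ec$). An element $M$ of $\mathrm{pSh}(\Omega,L)$ is a presheaf with: for each $n$-ary $R$ a map $R^M:|M|^n\to\Omega$ with $R^M(\bar a)\le E\bar a$ and $[\bar a=\bar b]_M\wedge R^M(\bar a)\le R^M(\bar b)$; for each $n$-ary $f$ a map $f^M:|M|^n\to|M|$ with $Ef^M(\bar a)=E\bar a$ and $[\bar a=\bar b]_M\le[f^M(\bar a)=f^M(\bar b)]_M$; for each constant $c$ a section $\mathfrak c^M$ with $E\mathfrak c^M=Ec$, compatibly with restriction. **Unnested atomic formulae** are those of the forms $v_i=v_j$, $v_i=c$, $R(v_{i_0},\dots,v_{i_{n-1}})$, $v_{i_n}=f(v_{i_0},\dots,v_{i_{n-1}})$. Their value $[\psi(\bar x)]_M\in\Omega$ at sections $\bar x$ is respectively $[x_i=x_j]_M$, $[x_i=\mathfrak c^M]_M$, $R^M(x_{i_0},\dots)$, $[x_{i_n}=f^M(x_{i_0},\dots)]_M$. **Partial isomorphisms.** For $A\subseteq|M|$, $\langle A\rangle=\{a\upharpoonright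 p:a\in A,p\in\Omega\}$. A partial isomorphism $h:M\to N$ is a bijection $h:A\to B$, $A\subseteq|M|$, $B\subseteq|N|$, with $[a_0=a_1]_M=[h(a_0)=h(a_1)]_N$ on $A$, such that, extending $h$ to $\langle A\rangle$ by $h(a\upharpoonright p)=h(a)\upharpoonright p$, every unnested atomic $\psi$ satisfies $[\psi(\bar x)]_M=[\psi(h(\bar x))]_N$ for all tuples $\bar x$ from $\langle A\rangle$. Domains, ranges, values and inclusions below refer to the extended maps; $h_q$ is the restriction of $h$ to sections of extent exactly $q$. **$Q_\alpha(p)$.** $Q_0(p)$ is the class of all partial isomorphisms between elements of $\mathrm{pSh}(\Omega,L)$; $Q_\alpha(p)=\bigcap_{\beta<\alpha}Q_\beta(p)$ for limit $\alpha$; $h:M\to N$ is in $Q_{\beta+1}(p)$ iff $h\in Q_\beta(p)$ and: (Forth) for every nonempty $\bar c=\langle c_i:i<\gamma\rangle$, $\gamma<\mu$, from $|M\upharpoonright p|$ there is a set $\{(h_j,q_j,\bar d_j):j\in J\}$ such that for each $j$: $h_j:M\to N$ is in $Q_\beta(q_j)$, $h_{q_j}\subseteq h_j$, $\bar d_j=\langle d_{ji}:i<\gamma\rangle$ is from $|N\upharpoonright E\bar c|$, $E\bar d_j=q_j$, $c_i\upharpoonright q_j\in\mathrm{dom}(h_j)$ and $h_j(c_i\upharpoonright q_j)=d_{ji}$ for all $i<\gamma$; and $\bigvee_jq_j=E\bar c$; (Back) for every nonempty $\bar d=\langle d_i:i<\gamma\rangle$, $\gamma<\mu$, from $|N\upharpoonright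 p|$ there is a set $\{(h_j,q_j,\bar c_j):j\in J\}$ such that for each $j$: $h_j\in Q_\beta(q_j)$, $h_{q_j}\subseteq h_j$, $\bar c_j=\langle c_{ji}\rangle$ is from $|M\upharpoonright E\bar d|$, $E\bar c_j=q_j$, $h_j(c_{ji})=d_i\upharpoonright q_j$ for all $i$; and $\bigvee_jq_j=E\bar d$. **Functions $F^\alpha_{M,\bar a}$** (values in $\Omega$). $F^0_{M,\bar a}=I_{M,\bar a}$, where $I_{M,\bar a}$ has as domain all $(\psi,f)$ with $\psi$ an unnested atomic formula whose variables are exactly $v_0,\dots,v_{n-1}$ for some $n\in\omega$, and $f:\{0,\dots,n-1\}\to\mathrm{lh}(\bar a)$, and $I_{M,\bar a}(\psi,f)=[\psi(a_{f(0)},\dots,a_{f(n-1)})]_M$. At limits take unions. $F^{\alpha+1}_{M,\bar a}$ extends $F^\alpha_{M,\bar a}$ by new arguments $(F^\alpha_{K,\bar s\bar t},\alpha)$ where $K\in\mathrm{pSh}(\Omega,L)$, $\bar s\in{}^{\mathrm{lh}(\bar a)}|K|$, $\bar t\in{}^{<\mu}|K|$ is nonempty and $E\bar t\le E\bar a\wedge E\bar s$, with (well-defined) value $F^{\alpha+1}_{M,\bar a}(F^\alpha_{K,\bar s\bar t},\alpha)=\bigvee\{E\bar c:\bar c\in{}^{\mathrm{lh}(\bar t)}|M|,\ E\bar c\le E\bar t,\ F^\alpha_{K,(\bar s\bar t)\upharpoonright E\bar c}=F^\alpha_{M,\bar a\bar c}\}$. *)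

(* Defs.v *)
From HB Require Import structures.
From mathcomp Require Import all_boot all_order.
From mathcomp Require Import mathcomp_extra boolp classical_sets.

Set Implicit Arguments.
Unset Strict Implicit.
Unset Printing Implicit Defensive.

Import Order.TTheory.
Local Open Scope quotient_scope.
Local Open Scope order_scope.

(* [Node A f] stands for the ordinal sup_(a : A) (f a + 1); every well-founded
   relation on a type, in particular every well-order, is ranked by such trees.
   Distinct trees may stand for the same ordinal, hence the quotient [Ord]. *)
Inductive tree : Type := Node (A : Type) (f : A -> tree).

HB.instance Definition _ := gen_eqMixin tree.
HB.instance Definition _ := gen_choiceMixin tree.

Fixpoint tle (s t : tree) {struct s} : Prop :=
  match s, t with
  | Node A f, Node B g => forall a : A, exists b : B, tle (f a) (g b)
  end.

Definition tlt (s t : tree) : Prop :=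
  match t with Node B g => exists b : B, tle s (g b) end.

Lemma tle_refl s : tle s s.
Proof. by elim: s => A f IH /= a; exists a. Qed.

Lemma tle_trans s t u : tle s t -> tle t u -> tle s u.
Proof.
elim: s t u => A f IH [B g] [C h] st tu a.
have [b ab] := st a; have [c bc] := tu b.
by exists c; apply: IH ab bc.
Qed.

Lemma tleE A (f : A -> tree) t : tle (Node f) t <-> forall a, tlt (f a) t.
Proof. by case: t. Qed.

Lemma tlt_le_trans s t u : tlt s t -> tle t u -> tlt s u.
Proof.
case: t u => [B g] [C h] /= [b sb] tu; have [c bc] := tu b.
by exists c; apply: tle_trans sb bc.
Qed.

Lemma tle_lt_trans s t u : tle s t -> tlt t u -> tlt s u.
Proof. by case: u => [C h] /= st [c tc]; exists c; apply: tle_trans st tc. Qed.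

Lemma tltW s t : tlt s t -> tle s t.
Proof.
elim: s t => A f IH [B g] /= [b sb] a; exists b.
have /IH // : tlt (f a) (g b) by move/tleE : sb; apply.
Qed.

Lemma tlt_irr s : ~ tlt s s.
Proof.
elim: s => A f IH [a fa]; apply: (IH a).
by move/tleE : fa; apply.
Qed.

Lemma tle_or_lt s t : tle s t \/ tlt t s.
Proof.
elim: s t => A f IH [B g].
have [[a H]|H] := pselect (exists a, ~ tlt (f a) (Node g)); last first.
  by left; apply/tleE => a; apply: contrapT => na; apply: H; exists a.
right; exists a; apply/tleE => b.
by case: (IH a (g b)) => // fab; case: H; exists b.
Qed.

Lemma tlt_wf : well_founded tlt.
Proof.
suff H s t : tle t s -> Acc tlt t by move=> s; apply: (H s); exact: tle_refl.
elim: s t => A f IH t ts; constructor => u ut.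
have [a ua] : tlt u (Node f) by apply: tlt_le_trans ut ts.
exact: (IH a).
Qed.

Definition teqv (s t : tree) : bool := `[< tle s t /\ tle t s >].

Lemma teqv_refl : reflexive teqv.
Proof. by move=> s; apply/asboolP; split; exact: tle_refl. Qed.

Lemma teqv_sym : symmetric teqv.
Proof. by move=> s t; apply/asboolP/asboolP => -[]. Qed.

Lemma teqv_trans : transitive teqv.
Proof.
move=> t s u /asboolP[st ts] /asboolP[tu ut]; apply/asboolP; split.
- exact: tle_trans st tu.
- exact: tle_trans ut ts.
Qed.

Canonical teqv_equiv := EquivRel teqv teqv_refl teqv_sym teqv_trans.

Definition Ord : Type := {eq_quot teqv}.
HB.instance Definition _ := Choice.on Ord.
HB.instance Definition _ := EqQuotient.on Ord.

Definition ord_of (t : tree) : Ord := \pi_Ord t.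

Lemma ord_ofK t : teqv (repr (ord_of t)) t.
Proof. by rewrite -eqmodE /ord_of reprK. Qed.

Lemma ord_ofP s t : ord_of s = ord_of t <-> tle s t /\ tle t s.
Proof.
split=> [/eqP|H]; first by rewrite eqmodE => /asboolP.
by apply/eqP; rewrite eqmodE; apply/asboolP.
Qed.

Fact Ord_display : Order.disp_t. Proof. exact: Order.Disp tt tt. Qed.

Definition ole (x y : Ord) : bool := `[< tle (repr x) (repr y) >].

Lemma ole_refl : reflexive ole.
Proof. by move=> x; apply/asboolP; exact: tle_refl. Qed.

Lemma ole_anti : antisymmetric ole.
Proof.
move=> x y /andP[/asboolP xy /asboolP yx].
by rewrite -[x]reprK -[y]reprK; apply/ord_ofP.
Qed.

Lemma ole_trans : transitive ole.
Proof.
by move=> y x z /asboolP xy /asboolP yz; apply/asboolP; apply: tle_trans xy yz.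
Qed.

Lemma ole_total : total ole.
Proof.
move=> x y; apply/orP.
case: (tle_or_lt (repr x) (repr y)) => [?|/tltW ?]; [left|right];
  exact/asboolP.
Qed.

HB.instance Definition _ :=
  Order.Le_isPOrder.Build Ord_display Ord ole_refl ole_anti ole_trans.
HB.instance Definition _ := Order.POrder_isTotal.Build Ord_display Ord ole_total.

Lemma oleP (x y : Ord) : reflect (tle (repr x) (repr y)) (x <= y).
Proof. exact: asboolP. Qed.

Lemma oltP (x y : Ord) : reflect (tlt (repr x) (repr y)) (x < y).
Proof.
rewrite ltNge; apply: (iffP negP) => [H|H /oleP yx].
  by case: (tle_or_lt (repr y) (repr x)) => // /oleP.
exact: (tlt_irr (tlt_le_trans H yx)).
Qed.

Lemma olt_wf : well_founded (fun x y : Ord => x < y).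
Proof.
suff H t : forall x : Ord, repr x = t -> Acc (fun x y : Ord => x < y) x.
  by move=> x; apply: (H (repr x)).
elim/(well_founded_ind tlt_wf) : t => t IH x xt; constructor => y /oltP.
by rewrite xt => yt; apply: (IH _ yt).
Qed.

Definition tzero : tree := @Node False (fun F => match F with end).
Definition tsucc (t : tree) : tree := @Node unit (fun=> t).
Fixpoint tadd (s t : tree) {struct t} : tree :=
  match s, t with
  | Node A f, Node B g =>
      @Node (A + B) (fun x => match x with inl a => f a | inr b => tadd s (g b) end)
  end.

Definition ozero : Ord := ord_of tzero.
Definition osucc (x : Ord) : Ord := ord_of (tsucc (repr x)).
Definition oadd (x y : Ord) : Ord := ord_of (tadd (repr x) (repr y)).

Lemma olt_succ x : x < osucc x.
Proof.
apply/oltP; have /asboolP[_ H] := ord_ofK (tsucc (repr x)).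
by apply: tlt_le_trans H; exists tt; exact: tle_refl.
Qed.

Lemma olt_succP x y : (x < osucc y) = (x <= y).
Proof.
apply/idP/idP => [/oltP xy|xy]; last exact: le_lt_trans xy (olt_succ y).
have /asboolP[H _] := ord_ofK (tsucc (repr y)).
by apply/oleP; have [] := tlt_le_trans xy H.
Qed.

Lemma osucc_inj : injective osucc.
Proof.
by move=> x y xy; apply/le_anti; rewrite -!olt_succP -{1}xy olt_succ xy olt_succ.
Qed.

Lemma ole0x x : ozero <= x.
Proof.
apply/oleP; have /asboolP[H _] := ord_ofK tzero.
by apply: tle_trans H _; case: (repr x) => A f [].
Qed.

Lemma osucc_neq0 x : osucc x <> ozero.
Proof. by move=> x0; have := olt_succ x; rewrite x0 ltNge ole0x. Qed.

Definition ord_rec (P : Type) (z : P) (s : Ord -> P -> P)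
    (l : forall x : Ord, ({y : Ord | y < x} -> P) -> P) : Ord -> P :=
  Fix olt_wf (fun=> P) (fun x rec =>
    if pselect (x = ozero) is left _ then z else
    match pselect (exists y, x = osucc y) with
    | left e =>
        s (sval (cid e))
          (rec (sval (cid e))
               (eq_ind_r (fun w => is_true (sval (cid e) < w)) (olt_succ _) (svalP (cid e))))
    | right _ => @l x (fun y => rec (sval y) (svalP y))
    end).

Definition is_limit (x : Ord) : Prop :=
  x <> ozero /\ ~ exists y, x = osucc y.

Section OrdRecEquations.
Context (P : Type) (z : P) (s : Ord -> P -> P).
Context (l : forall x : Ord, ({y : Ord | y < x} -> P) -> P).

Let ord_rec_unfold x : ord_rec z s l x =
    if pselect (x = ozero) is left _ then z else
    match pselect (exists y, x = osucc y) with
    | left e => s (sval (cid e)) (ord_rec z s l (sval (cid e)))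
    | right _ => @l x (fun y => ord_rec z s l (sval y))
    end.
Proof.
rewrite {1}/ord_rec Fix_eq // => {}x f g fg.
suff -> : f = g by [].
by apply/functional_extensionality_dep => y; apply/funext => yx; exact: fg.
Qed.

Lemma ord_rec0 : ord_rec z s l ozero = z.
Proof. by rewrite ord_rec_unfold; case: pselect. Qed.

Lemma ord_recS x : ord_rec z s l (osucc x) = s x (ord_rec z s l x).
Proof.
rewrite ord_rec_unfold; case: pselect => [/osucc_neq0 //|_].
case: pselect => [e|[]]; last by exists x.
by case: (cid e) => y /= /osucc_inj ->.
Qed.

Lemma ord_rec_lim x : is_limit x ->
  ord_rec z s l x = @l x (fun y => ord_rec z s l (sval y)).
Proof. by case=> ? ?; rewrite ord_rec_unfold; case: pselect => // _; case: pselect. Qed.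

End OrdRecEquations.

Definition idx (g : Ord) : Type := {i : Ord | i < g}.

(* Cardinals are the initial ordinals. *)
Definition is_cardinal (m : Ord) : Prop :=
  forall g, g < m -> ~ exists f : idx m -> idx g, injective f.

Lemma tadd_mono s t u : tle t u -> tle (tadd s t) (tadd s u).
Proof.
elim: t u => B g IH [C h] /= tu; case: s IH => A f IH /= [a|b].
  by exists (inl a); exact: tle_refl.
by have [c bc] := tu b; exists (inr c); exact: IH.
Qed.

Lemma tadd_ltr s t u : tlt t u -> tlt (tadd s t) (tadd s u).
Proof.
case: u => C h /= [c tc]; case: s => A f /=.
by exists (inr c); exact: tadd_mono.
Qed.

Lemma tle_addr s t : tle s (tadd s t).
Proof.
by case: s t => A f [B g] /= a; exists (inl a); exact: tle_refl.
Qed.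

Lemma tsub s t u : tle s u -> tlt u (tadd s t) ->
  exists2 v, tlt v t & tle u (tadd s v) /\ tle (tadd s v) u.
Proof.
elim: t => B g IH su; rewrite /tlt; case Es : s => [A f] /=; rewrite -Es.
case=> -[a|b] ux.
  have : tlt u u; last by move/tlt_irr.
  by apply: tlt_le_trans su; rewrite Es; exists a.
have [sgu|/(IH b su)[v vb H]] := tle_or_lt (tadd s (g b)) u.
  by exists (g b) => //; exists b; exact: tle_refl.
by exists v => //; exists b; exact: tltW.
Qed.

Lemma osub (g d i : Ord) : g <= i -> i < oadd g d ->
  exists2 j, j < d & i = oadd g j.
Proof.
move=> /oleP gi /oltP ij.
have /asboolP[H _] := ord_ofK (tadd (repr g) (repr d)).
have [v vd [H1 H2]] := tsub gi (tlt_le_trans ij H).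
have /asboolP[H3 H4] := ord_ofK v.
exists (ord_of v); first by apply/oltP; exact: tle_lt_trans H3 vd.
rewrite -[i]reprK; apply/ord_ofP; split.
- exact: tle_trans H1 (tadd_mono _ H4).
- exact: tle_trans (tadd_mono _ H3) H2.
Qed.

Lemma oadd_ltr (g i j : Ord) : i < j -> oadd g i < oadd g j.
Proof.
move=> /oltP ij; apply/oltP.
have /asboolP[H _] := ord_ofK (tadd (repr g) (repr i)).
have /asboolP[_ H'] := ord_ofK (tadd (repr g) (repr j)).
exact: tlt_le_trans (tle_lt_trans H (tadd_ltr _ ij)) H'.
Qed.

Lemma ole_addr (g d : Ord) : g <= oadd g d.
Proof.
apply/oleP; have /asboolP[_ H] := ord_ofK (tadd (repr g) (repr d)).
exact: tle_trans (tle_addr _ _) H.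
Qed.

Lemma oadd_inj (g : Ord) : injective (oadd g).
Proof.
move=> i j ij; case: (ltgtP i j) => // /(oadd_ltr g); by rewrite ij ltxx.
Qed.

Lemma idx_split (g d : Ord) (k : idx (oadd g d)) : ~ sval k < g ->
  {j : idx d | sval k = oadd g (sval j)}.
Proof.
move=> /negP; rewrite -leNgt => gk; apply: cid.
by have [j jd kj] := osub gk (svalP k); exists (exist _ j jd).
Qed.

(* Concatenation: entry i is a_i for i < g, and c_j for i = g + j. *)
Definition tcat (X : Type) (g d : Ord) (a : idx g -> X) (c : idx d -> X) :
    idx (oadd g d) -> X :=
  fun k => match pselect (sval k < g) with
           | left kg => a (exist _ (sval k) kg)
           | right kg => c (sval (idx_split kg))
           end.

Lemma idx_val_inj (g : Ord) (i j : idx g) : sval i = sval j -> i = j.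
Proof. by case: i j => [i ig] [j jg] /= ij; exact: eq_exist. Qed.

Lemma tcatl X g d (a : idx g -> X) (c : idx d -> X) (i : idx g)
  (k : idx (oadd g d)) : sval k = sval i -> tcat a c k = a i.
Proof.
move=> ki; rewrite /tcat; case: pselect => [kg|[]]; last by rewrite ki; case: i {ki}.
by congr a; exact: idx_val_inj.
Qed.

Lemma tcatr X g d (a : idx g -> X) (c : idx d -> X) (j : idx d)
  (k : idx (oadd g d)) : sval k = oadd g (sval j) -> tcat a c k = c j.
Proof.
move=> kj; rewrite /tcat; case: pselect => [kg|kg].
  by exfalso; move: kg; rewrite kj ltNge ole_addr.
by case: idx_split => j' /= H; congr c; apply/idx_val_inj/(@oadd_inj g); rewrite -H.
Qed.

HB.mixin Record isCompleteHeyting d T of Order.TBLattice d T := {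
  hsup : set T -> T;
  himp : T -> T -> T;
  hsupP : forall A : set T, supremums A (hsup A);
  himpP : forall x y z : T, (z <= himp x y) = (z `&` x <= y) }.

#[short(type="completeHeytingType")]
HB.structure Definition CompleteHeyting d :=
  {T of isCompleteHeyting d T & Order.TBLattice d T}.

Definition hinf d (O : completeHeytingType d) (A : set O) : O := hsup (lbound A).

Definition psh_eqv d (O : completeHeytingType d) (X : Type)
    (E : X -> O) (res : X -> O -> X) (a b : X) : O :=
  hsup [set p | (p <= E a `&` E b)%O /\ res a p = res b p]%classic.

Record presheaf d (O : completeHeytingType d) := Presheaf {
  section :> Type;
  ext : section -> O;
  res : section -> O -> section;
  res_ext : forall a, res a (ext a) = a;
  ext_res : forall a p, ext (res a p) = ext a `&` p;
  res_res : forall a p q, res (res a p) q = res a (p `&` q);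
  psh_extensional : forall a b,
    ext a = psh_eqv ext res a b -> ext b = psh_eqv ext res a b -> a = b }.

Section PresheafTuples.
Context d (O : completeHeytingType d) (M : presheaf O).

Definition seq_val (a b : M) : O := psh_eqv (@ext _ _ M) (@res _ _ M) a b.

(* Tuples are families over a type I: 'I_n, or idx g for ordinal lengths g. *)
Definition text (I : Type) (x : I -> M) : O := hinf (range (fun i => ext (x i))).

Definition tres (I : Type) (x : I -> M) (p : O) : I -> M := fun i => res (x i) p.

Definition teq_val (I : Type) (x y : I -> M) : O :=
  hinf (range (fun i => seq_val (x i) (y i))).

(* Tuples are normally taken with all entries of the same extent; the empty
   tuple has extent \top. *)
Definition same_ext (I : Type) (x : I -> M) : Prop := forall i, ext (x i) = text x.

(* The tuple written "a c": a restricted to the extent of c, followed by c. *)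
Definition cat_res (g d : Ord) (a : idx g -> M) (c : idx d -> M) :
  idx (oadd g d) -> M := tcat (tres a (text c)) c.

End PresheafTuples.

Record signature d (O : completeHeytingType d) := Signature {
  rels : Type;
  rel_arity : rels -> nat;
  funs : Type;
  fun_arity : funs -> nat;
  consts : presheaf O }.

Record pstruct d (O : completeHeytingType d) (L : signature O) := PStruct {
  carrier :> presheaf O;
  rel_int : forall R : rels L, ('I_(rel_arity R) -> carrier) -> O;
  rel_ext : forall (R : rels L) (x : 'I_(rel_arity R) -> carrier),
    rel_int x <= text x;
  rel_eqv : forall (R : rels L) (x y : 'I_(rel_arity R) -> carrier),
    teq_val x y `&` rel_int x <= rel_int y;
  fun_int : forall f : funs L, ('I_(fun_arity f) -> carrier) -> carrier;
  fun_ext : forall (f : funs L) (x : 'I_(fun_arity f) -> carrier),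
    ext (fun_int x) = text x;
  fun_eqv : forall (f : funs L) (x y : 'I_(fun_arity f) -> carrier),
    teq_val x y <= seq_val (fun_int x) (fun_int y);
  const_int : consts L -> carrier;
  const_ext : forall c : consts L, ext (const_int c) = ext c;
  const_res : forall (c : consts L) (p : O),
    const_int (res c p) = res (const_int c) p }.

Arguments rel_int {d O L} M R x : rename.
Arguments fun_int {d O L} M f x : rename.
Arguments const_int {d O L} M c : rename.

(* Unnested atomic formulae with variables among v_0, ..., v_(n-1). *)
Inductive uatom d (O : completeHeytingType d) (L : signature O) (n : nat) : Type :=
| AEq (i j : 'I_n)
| AConst (i : 'I_n) (c : consts L)
| ARel (R : rels L) (v : 'I_(rel_arity R) -> 'I_n)
| AFun (f : funs L) (v : 'I_(fun_arity f) -> 'I_n) (i : 'I_n).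

Section Atoms.
Context d (O : completeHeytingType d) (L : signature O) (n : nat).

Definition occurs (k : 'I_n) (psi : uatom L n) : Prop :=
  match psi with
  | AEq i j => k = i \/ k = j
  | AConst i _ => k = i
  | ARel R v => exists m, k = v m
  | AFun f v i => k = i \/ exists m, k = v m
  end.

Definition aval (M : pstruct L) (psi : uatom L n) (x : 'I_n -> M) : O :=
  match psi with
  | AEq i j => seq_val (x i) (x j)
  | AConst i c => seq_val (x i) (const_int M c)
  | ARel R v => rel_int M R (fun m => x (v m))
  | AFun f v i => seq_val (x i) (fun_int M f (fun m => x (v m)))
  end.

End Atoms.

(* The extension to <A> of a map with graph h, as a relation. *)
Definition extend d (O : completeHeytingType d) (M N : presheaf O)
    (h : M -> N -> Prop) (x : M) (y : N) : Prop :=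
  exists a b p, [/\ h a b, x = res a p & y = res b p].

(* The map is given by its graph: pi_graph a b means that a is in the domain A
   and is sent to b. *)
Record piso d (O : completeHeytingType d) (L : signature O) (M N : pstruct L) :=
  PIso {
    pi_graph : M -> N -> Prop;
    pi_fun : forall a b b', pi_graph a b -> pi_graph a b' -> b = b';
    pi_inj : forall a a' b, pi_graph a b -> pi_graph a' b -> a = a';
    pi_eqv : forall a0 a1 b0 b1, pi_graph a0 b0 -> pi_graph a1 b1 ->
      seq_val a0 a1 = seq_val b0 b1;
    pi_atom : forall n (psi : uatom L n) (x : 'I_n -> M) (y : 'I_n -> N),
      (forall i, extend pi_graph (x i) (y i)) -> aval psi x = aval psi y }.

Section BackAndForth.
Context d (O : completeHeytingType d) (L : signature O) (mu : Ord).

Definition maps (M N : pstruct L) (h : piso M N) (x : M) (y : N) : Prop :=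
  extend (@pi_graph _ _ _ _ _ h) x y.

(* Inclusion of h_q in h', where h_q is h on sections of extent exactly q. *)
Definition sub_at (M N : pstruct L) (q : O) (h h' : piso M N) : Prop :=
  forall x y, maps h x y -> ext x = q -> maps h' x y.

Definition piso_class := forall (p : O) (M N : pstruct L), piso M N -> Prop.

(* S is the set of the triples (h_j, q_j, d_j). *)
Definition forth (Qb : piso_class) (p : O) (M N : pstruct L) (h : piso M N) : Prop :=
  forall (g : Ord) (c : idx g -> M), ozero < g -> g < mu ->
    same_ext c -> (forall i, ext (c i) <= p) ->
  exists S : set (piso M N * O * (idx g -> N)),
    (forall h' q e, S (h', q, e) ->
       [/\ Qb q M N h', sub_at q h h', same_ext e /\ text e = q,
           forall i, ext (e i) <= text c
         & forall i, maps h' (res (c i) q) (e i)]) /\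
    hsup [set x.1.2 | x in S]%classic = text c.

Definition back (Qb : piso_class) (p : O) (M N : pstruct L) (h : piso M N) : Prop :=
  forall (g : Ord) (e : idx g -> N), ozero < g -> g < mu ->
    same_ext e -> (forall i, ext (e i) <= p) ->
  exists S : set (piso M N * O * (idx g -> M)),
    (forall h' q c, S (h', q, c) ->
       [/\ Qb q M N h', sub_at q h h', same_ext c /\ text c = q,
           forall i, ext (c i) <= text e
         & forall i, maps h' (c i) (res (e i) q)]) /\
    hsup [set x.1.2 | x in S]%classic = text e.

Definition Q : Ord -> piso_class :=
  ord_rec
    (fun p M N h => True)
    (fun _ Qb p M N h => [/\ Qb p M N h, forth Qb p h & back Qb p h])
    (fun _ Qs p M N h => forall b, Qs b p M N h).

End BackAndForth.

(* A pair (psi, f) in the domain of I_{M,a}; f is a map into the ordinals. *)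
Record atom_arg d (O : completeHeytingType d) (L : signature O) := AtomArg {
  aa_n : nat;
  aa_psi : uatom L aa_n;
  aa_f : 'I_aa_n -> Ord }.

(* Set-theoretic functions with values in O given by their graphs, i.e. as the
   set of the pairs (fg_arg x, fg_val x); an argument is either a pair (psi, f)
   or a pair (function of the same kind, ordinal). *)
Inductive sfun d (O : completeHeytingType d) (L : signature O) : Type :=
| SFun (X : Type) (arg : X -> farg L) (val : X -> O)
with farg d (O : completeHeytingType d) (L : signature O) : Type :=
| ArgAtom (x : atom_arg L)
| ArgFun (G : sfun L) (alpha : Ord).

(* Equality of the represented functions: both graphs have the same elements,
   arguments which are themselves functions being compared recursively. *)
Fixpoint sfun_eq d (O : completeHeytingType d) (L : signature O)
    (G H : sfun L) {struct G} : Prop :=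
  match G, H with
  | SFun X ax vx, SFun Y ay vy =>
      (forall x, exists y, farg_eq (ax x) (ay y) /\ vx x = vy y) /\
      (forall y, exists x, farg_eq (ax x) (ay y) /\ vx x = vy y)
  end
with farg_eq d (O : completeHeytingType d) (L : signature O)
    (u v : farg L) {struct u} : Prop :=
  match u, v with
  | ArgAtom x, ArgAtom y => x = y
  | ArgFun G alpha, ArgFun H beta => sfun_eq G H /\ alpha = beta
  | _, _ => False
  end.

Section Functions.
Context d (O : completeHeytingType d) (L : signature O) (mu : Ord).

Definition fg_dom (G : sfun L) : Type := let: SFun X _ _ := G in X.
Definition fg_arg (G : sfun L) : fg_dom G -> farg L :=
  let: SFun _ arg _ := G in arg.
Definition fg_val (G : sfun L) : fg_dom G -> O :=
  let: SFun _ _ val := G in val.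

Definition fg_union (J : Type) (G : J -> sfun L) : sfun L :=
  @SFun _ _ L {j : J & fg_dom (G j)}
    (fun x => fg_arg (projT2 x)) (fun x => fg_val (projT2 x)).

Definition fg_union2 (G H : sfun L) : sfun L :=
  fg_union (fun b : bool => if b then G else H).

Definition fun_family := forall (M : pstruct L) (g : Ord), (idx g -> M) -> sfun L.

Record atom_index (g : Ord) := AtomIndex {
  ai_n : nat;
  ai_psi : uatom L ai_n;
  ai_exact : forall k, occurs k ai_psi;
  ai_f : 'I_ai_n -> idx g }.

Arguments ai_f {g} x k : rename.

Definition I_fun : fun_family := fun M g a =>
  @SFun _ _ L (atom_index g)
    (fun x => ArgAtom (AtomArg (ai_psi x) (fun k => sval (ai_f x k))))
    (fun x => aval (ai_psi x) (fun k => a (ai_f x k))).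

(* The data (K, s, t) of the arguments (F^alpha_{K,st}, alpha) which are new in
   F^(alpha+1)_{M,a}. *)
Record new_index (M : pstruct L) (g : Ord) (a : idx g -> M) := NewIndex {
  ni_K : pstruct L;
  ni_s : idx g -> ni_K;
  ni_len : Ord;
  ni_t : idx ni_len -> ni_K;
  ni_nonempty : ozero < ni_len;
  ni_lt : ni_len < mu;
  ni_same_s : same_ext ni_s;
  ni_same_t : same_ext ni_t;
  ni_ext : text ni_t <= text a `&` text ni_s }.

Arguments ni_t {M g a} x i : rename.

Definition new_val (Fa : fun_family) (M : pstruct L) (g : Ord) (a : idx g -> M)
    (x : new_index a) : O :=
  hsup [set q | exists c : idx (ni_len x) -> M,
    [/\ same_ext c, text c <= text (ni_t x),
        sfun_eq (Fa _ _ (tres (cat_res (ni_s x) (ni_t x)) (text c)))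
                (Fa _ _ (cat_res a c))
      & q = text c]]%classic.

Definition new_fun (alpha : Ord) (Fa : fun_family) : fun_family := fun M g a =>
  @SFun _ _ L (new_index a)
    (fun x => ArgFun (Fa _ _ (cat_res (ni_s x) (ni_t x))) alpha)
    (fun x => new_val Fa x).

Definition F : Ord -> fun_family :=
  ord_rec
    I_fun
    (fun alpha Fa M g a => fg_union2 (Fa M g a) (new_fun alpha Fa a))
    (fun _ Fs M g a => fg_union (fun b => Fs b M g a)).

End Functions.

(* Main.v *)
(* Unfolding the transfinite recursions, F^alpha_a is the disjoint union of I_a
   and of the new arguments of all stages gamma < alpha, and h lies in
   Q_alpha(p) iff it has the forth and back properties with respect to Q_gamma
   for all gamma < alpha; so one can argue by strong induction on alpha, without
   a limit case.  Given h, the forth property turns a witness c for an argument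
   (K, s, t) over M into a cover by witnesses over N, and the inverse of h gives
   the other inequality.  Conversely, if the functions agree, the smallest
   candidate a_i |-> b_i is a partial isomorphism since I_a = I_b, and it is in
   Q_alpha(p): the value at the argument obtained from c itself is E c, and
   equality of this value over N says that matching tuples of N cover E c.
   Lengths and extents are recovered from the formulae v_0 = v_0. *)
Require Import Defs.
From mathcomp Require Import all_boot all_order.
From mathcomp Require Import mathcomp_extra boolp classical_sets.
Local Open Scope order_scope.

Set Implicit Arguments.
Unset Strict Implicit.
Unset Printing Implicit Defensive.

Import Order.TTheory.

Arguments aa_f {d O L} u k : rename.
Arguments ai_f {d O L g} x k : rename.
Arguments ni_t {d O L mu M g a} x i : rename.
Arguments ni_s {d O L mu M g a} x i : rename.

(** * Suprema and infima in a complete Heyting algebra *)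

Section CompleteHeyting.
Context d (O : completeHeytingType d).
Implicit Types (A : set O) (x y z : O).

Lemma hsup_ub A x : A x -> x <= hsup A.
Proof. by move=> Ax; have [+ _] := hsupP A; apply. Qed.

Lemma hsup_le A z : (forall x, A x -> x <= z) -> hsup A <= z.
Proof. by move=> Az; have [_] := hsupP A; apply=> x; exact: Az. Qed.

Lemma le_hinf A z : z <= hinf A <-> forall x, A x -> z <= x.
Proof.
split=> [zA x Ax|zA]; last by apply: hsup_ub => x; exact: zA.
by apply: le_trans zA _; apply: hsup_le => y; apply.
Qed.

(** Equalities in [O] are reduced to comparing the elements q below both sides, that is, to truth at
    stage q. *)
Lemma eq_by_le x y : (forall q, q <= x <-> q <= y) -> x = y.
Proof. by move=> xy; apply: le_anti; apply/andP; split; apply/xy. Qed.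

End CompleteHeyting.

(** * Equality values, extents and tuples in a presheaf *)

Section Presheaf.
Context d (O : completeHeytingType d) (M : presheaf O).
Implicit Types (x y : M) (p q : O).

Lemma res_le x p q : p <= q -> res (res x q) p = res x p.
Proof. by move=> pq; rewrite res_res meetC (meet_l pq). Qed.

Lemma ext_res_le x q : q <= ext x -> ext (res x q) = q.
Proof. by move=> qx; rewrite ext_res meetC (meet_l qx). Qed.

(** By extensionality the supremum u = [x = y] belongs to its own defining set: x and y restricted
    to u have extent u and equality value u, so they coincide. *)
Lemma le_seq_val x y q :
  q <= seq_val x y <-> [/\ q <= ext x, q <= ext y & res x q = res y q].
Proof.
split=> [|[qx qy xy]]; last by apply: hsup_ub; rewrite /= lexI qx qy.
set u := seq_val x y; have [ux uy] : u <= ext x /\ u <= ext y.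
  by split; apply: hsup_le => p /= [+ _]; rewrite lexI => /andP[].
have uu : u <= seq_val (res x u) (res y u).
  apply: hsup_le => p xyp; have pu : p <= u by exact: hsup_ub.
  by apply: hsup_ub; rewrite /= !ext_res_le // lexI pu !res_le //; case: xyp.
have le_u : seq_val (res x u) (res y u) <= u.
  by apply: hsup_le => p [+ _]; rewrite !ext_res_le // lexI => /andP[].
have uE : u = seq_val (res x u) (res y u) by apply: le_anti; rewrite uu le_u.
have xyu : res x u = res y u.
  by apply: psh_extensional; rewrite ext_res_le.
by move=> qu; rewrite -(res_le x qu) -(res_le y qu) xyu; split=> //;
  apply: le_trans qu _.
Qed.

Lemma seq_valC x y : seq_val x y = seq_val y x.
Proof. by apply: eq_by_le => q; split=> /le_seq_val[? ? ?]; apply/le_seq_val. Qed.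

Lemma seq_valxx x : seq_val x x = ext x.
Proof.
by apply: eq_by_le => q; split=> [/le_seq_val[]|qx] //; apply/le_seq_val.
Qed.

Lemma seq_val_trans q x y z :
  q <= seq_val x y -> q <= seq_val y z -> q <= seq_val x z.
Proof.
by move=> /le_seq_val[qx _ xy] /le_seq_val[_ qz yz]; apply/le_seq_val; rewrite xy.
Qed.

Lemma le_text I (x : I -> M) q : q <= text x <-> forall i, q <= ext (x i).
Proof.
split=> [/le_hinf qx i|qx]; first by apply: qx; exists i.
by apply/le_hinf => _ [i _ <-].
Qed.

Lemma le_teq_val I (x y : I -> M) q :
  q <= teq_val x y <-> forall i, q <= seq_val (x i) (y i).
Proof.
split=> [/le_hinf qx i|qx]; first by apply: qx; exists i.
by apply/le_hinf => _ [i _ <-].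
Qed.

(* For an empty tuple this forces p = \top. *)
Definition uniform p I (x : I -> M) := (forall i, ext (x i) = p) /\ text x = p.

Lemma uniform_text p I (x : I -> M) : uniform p x -> text x = p.
Proof. by case. Qed.

Lemma uniform_ext p I (x : I -> M) i : uniform p x -> ext (x i) = p.
Proof. by case. Qed.

Lemma same_ext_uniform I (x : I -> M) : same_ext x -> uniform (text x) x.
Proof. by []. Qed.

Lemma uniform_same_ext p I (x : I -> M) : uniform p x -> same_ext x.
Proof. by case=> xp tx i; rewrite xp tx. Qed.

Lemma uniform_inhabited p I (x : I -> M) :
  inhabited I -> (forall i, ext (x i) = p) -> uniform p x.
Proof.
move=> [i0] xp; split=> //; apply: eq_by_le => q; split=> [/le_text/(_ i0)|qp].
  by rewrite xp.
by apply/le_text => i; rewrite xp.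
Qed.

Lemma idx_inhabited g : ozero < g -> inhabited (idx g).
Proof. by move=> g0; split; exists ozero. Qed.

Lemma oadd_gt0 g e : ozero < e -> ozero < oadd g e.
Proof. by move=> e0; apply: le_lt_trans (oadd_ltr g e0); exact: ole0x. Qed.

Lemma uniform_tres p q g (x : idx g -> M) :
  ozero < g -> uniform p x -> q <= p -> uniform q (tres x q).
Proof.
move=> g0 [xp _] qp; apply: uniform_inhabited (idx_inhabited g0) _ => i.
by rewrite ext_res_le ?xp.
Qed.

Definition idx_l g e (i : idx g) : idx (oadd g e) :=
  exist _ (sval i) (lt_le_trans (svalP i) (ole_addr g e)).

Definition idx_r g e (j : idx e) : idx (oadd g e) :=
  exist _ (oadd g (sval j)) (oadd_ltr g (svalP j)).

Lemma idx_cat g e (k : idx (oadd g e)) :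
  (exists i, k = idx_l e i) \/ (exists j, k = idx_r g j).
Proof.
case: (pselect (sval k < g)) => [kg|/idx_split[j kj]].
  by left; exists (exist _ (sval k) kg); exact: idx_val_inj.
by right; exists j; exact: idx_val_inj.
Qed.

Lemma cat_res_l g e (x : idx g -> M) (y : idx e -> M) i :
  cat_res x y (idx_l e i) = res (x i) (text y).
Proof. exact: tcatl. Qed.

Lemma cat_res_r g e (x : idx g -> M) (y : idx e -> M) j :
  cat_res x y (idx_r g j) = y j.
Proof. exact: tcatr. Qed.

Lemma uniform_cat p q g e (x : idx g -> M) (y : idx e -> M) :
  ozero < e -> uniform p x -> uniform q y -> q <= p -> uniform q (cat_res x y).
Proof.
move=> e0 [xp _] [yq tq] qp.
apply: uniform_inhabited (idx_inhabited (oadd_gt0 g e0)) _ => k.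
have [[i ->]|[j ->]] := idx_cat k; last by rewrite cat_res_r.
by rewrite cat_res_l tq ext_res_le ?xp.
Qed.

Lemma tres_cat q g e (x : idx g -> M) (y : idx e -> M) :
  ozero < e -> same_ext y -> q <= text y ->
  tres (cat_res x y) q = cat_res x (tres y q).
Proof.
move=> e0 yu qy; have [_ tq] := uniform_tres e0 (same_ext_uniform yu) qy.
apply/funext => k; rewrite /tres; have [[i ->]|[j ->]] := idx_cat k.
  by rewrite !cat_res_l tq res_le.
by rewrite !cat_res_r.
Qed.

Lemma tres_tres I (x : I -> M) p q : q <= p -> tres (tres x p) q = tres x q.
Proof. by move=> qp; apply/funext => i; rewrite /tres res_le. Qed.

Lemma tres_id p I (x : I -> M) : uniform p x -> tres x p = x.
Proof. by move=> [xp _]; apply/funext => i; rewrite /tres -(xp i) res_ext. Qed.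

End Presheaf.

(** * Values of unnested atomic formulae *)

Section Atoms.
Context d (O : completeHeytingType d) (L : signature O).
Implicit Types (M N : pstruct L).

Lemma aval_le_ext M n (psi : uatom L n) (x : 'I_n -> M) k :
  occurs k psi -> aval psi x <= ext (x k).
Proof.
case: psi => /= [i j|i c|R v|f v i].
- have /le_seq_val[? ? _] := lexx (seq_val (x i) (x j)).
  by case=> ->.
- by have /le_seq_val[? _ _] := lexx (seq_val (x i) (const_int M c)) => ->.
- by case=> m ->; have /le_text := rel_ext (fun m => x (v m)); apply.
- have /le_seq_val[? + _] := lexx (seq_val (x i) (fun_int M f (fun m => x (v m)))).
  by rewrite fun_ext => /le_text xv [->|[m ->]].
Qed.

Lemma aval_congr M n (psi : uatom L n) (x y : 'I_n -> M) q :
  (forall k, occurs k psi -> q <= seq_val (x k) (y k)) ->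
  q <= aval psi x -> q <= aval psi y.
Proof.
case: psi => /= [i j|i c|R v|f v i] xy qx.
- apply: seq_val_trans (xy j _); last by right.
  by apply: seq_val_trans qx; rewrite seq_valC; apply: xy; left.
- by apply: seq_val_trans qx; rewrite seq_valC; exact: xy.
- apply: le_trans (rel_eqv (fun m => x (v m)) _); rewrite lexI qx andbT.
  by apply/le_teq_val => m; apply: xy; exists m.
- apply: (@seq_val_trans _ _ _ _ _ (fun_int M f (fun m => x (v m)))).
    by apply: seq_val_trans qx; rewrite seq_valC; apply: xy; left.
  apply: le_trans (fun_eqv (fun m => x (v m)) _).
  by apply/le_teq_val => m; apply: xy; right; exists m.
Qed.

(** Below the extent of x_k and below r_k, the section x_k and its restriction to r_k are equal, so
    [aval_congr] exchanges them in both directions. Values on all restrictions are thus determined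
    by values on the original sections. *)
Lemma le_aval_res M n (psi : uatom L n) (x : 'I_n -> M) (r : 'I_n -> O) q :
  q <= aval psi (fun k => res (x k) (r k)) <->
  (forall k, occurs k psi -> q <= ext (x k) /\ q <= r k) /\ q <= aval psi x.
Proof.
have xr k : q <= ext (x k) -> q <= r k -> q <= seq_val (x k) (res (x k) (r k)).
  by move=> qx qr; apply/le_seq_val; rewrite ext_res lexI qx res_le.
split=> [qa|[occ]]; last first.
  by apply: aval_congr => k /occ[]; exact: xr.
have occ k : occurs k psi -> q <= ext (x k) /\ q <= r k.
  move=> ok; apply/andP; rewrite -lexI -ext_res.
  exact: le_trans qa (aval_le_ext _ ok).
split=> //; apply: aval_congr qa => k /occ[? ?].
by rewrite seq_valC; exact: xr.
Qed.

(* Variables may be duplicated, as f need not be injective; hence every formula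
   can be replaced by one in which each variable occurs exactly once. *)
Lemma aval_exact M N g (a : idx g -> M) (b : idx g -> N) :
  (forall x : atom_index L g,
     aval (ai_psi x) (fun k => a (ai_f x k)) =
     aval (ai_psi x) (fun k => b (ai_f x k))) ->
  forall n (psi : uatom L n) (f : 'I_n -> idx g),
    aval psi (fun k => a (f k)) = aval psi (fun k => b (f k)).
Proof.
move=> ab n [i j|i c|R v|h v i] f.
- have ex (k : 'I_2) : occurs k (@AEq _ _ L 2 ord0 ord_max).
    by case: k => -[|[|//]] ?; [left|right]; exact: val_inj.
  exact: (ab (AtomIndex ex (fun k => if k == ord0 then f i else f j))).
- have ex (k : 'I_1) : occurs k (@AConst _ _ L 1 ord0 c) by exact: ord1.
  exact: (ab (AtomIndex ex (fun=> f i))).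
- have ex (k : 'I_(rel_arity R)) : occurs k (@ARel _ _ L _ R id) by exists k.
  exact: (ab (AtomIndex ex (fun k => f (v k)))).
(* The formula is v_n = h(v_0, ..., v_(n-1)) with n the arity of h: [w] embeds the arguments as the
   first n variables, and the last variable is kept for the value. *)
- set w := lift (@ord_max (fun_arity h)).
  have ex k : occurs k (@AFun _ _ L _ h w ord_max).
    by case: (unliftP ord_max k) => [m ->|->]; [right; exists m|left].
  have := ab (AtomIndex ex (fun k => oapp (fun m => f (v m)) (f i) (unlift ord_max k))).
  rewrite /= unlift_none /=.
  have wK (T : Type) (z : idx g -> T) :
      (fun m => z (oapp (fun m => f (v m)) (f i) (unlift ord_max (w m)))) =
      (fun m => z (f (v m))).
    by apply/funext => m; rewrite liftK.
  by rewrite !wK.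
Qed.

End Atoms.

(** * Equality of functions represented by their graphs *)

Section FunctionGraphs.
Context d (O : completeHeytingType d) (L : signature O).
Implicit Types (G H : sfun L) (u : farg L).

Fixpoint sfun_eq_refl G : sfun_eq G G :=
  let: SFun X ax vx := G in
  conj (fun x => ex_intro _ x (conj (farg_eq_refl (ax x)) erefl))
       (fun x => ex_intro _ x (conj (farg_eq_refl (ax x)) erefl))
with farg_eq_refl u : farg_eq u u :=
  match u with
  | ArgAtom x => erefl
  | ArgFun G alpha => conj (sfun_eq_refl G) erefl
  end.

Fixpoint sfun_eq_sym G H {struct G} : sfun_eq G H -> sfun_eq H G
with farg_eq_sym u (v : farg L) {struct u} : farg_eq u v -> farg_eq v u.
Proof.
- case: G H => [X ax vx] [Y ay vy] /= [GH HG]; split=> [y|x].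
    by have [x [/farg_eq_sym ? ?]] := HG y; exists x.
  by have [y [/farg_eq_sym ? ?]] := GH x; exists y.
- by case: u v => [x|G alpha] [y|H beta] //= [/sfun_eq_sym ? ->].
Qed.

Fixpoint sfun_eq_trans G H K {struct G} :
  sfun_eq G H -> sfun_eq H K -> sfun_eq G K
with farg_eq_trans u (v w : farg L) {struct u} : farg_eq u v -> farg_eq v w -> farg_eq u w.
Proof.
- case: G H K => [X ax vx] [Y ay vy] [Z az vz] /= [GH HG] [HK KH]; split=> [x|z].
    have [y [xy ->]] := GH x; have [z [yz ->]] := HK y; exists z; split=> //.
    exact: farg_eq_trans xy yz.
  have [y [yz <-]] := KH z; have [x [xy <-]] := HG y; exists x; split=> //.
  exact: farg_eq_trans xy yz.
- case: u v w => [x|G alpha] [y|H beta] [z|K gamma] //= [].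
    by move=> -> ->.
  by move=> GH -> [HK ->]; split=> //; exact: sfun_eq_trans GH HK.
Qed.

(** Membership is taken up to [farg_eq], as different codes may represent the same argument;
    [sfun_eq] then becomes extensional equality of graphs. *)
Definition in_graph G u (v : O) :=
  exists x : fg_dom G, farg_eq u (fg_arg x) /\ v = fg_val x.

Lemma sfun_eqP G H :
  sfun_eq G H <-> forall u v, in_graph G u v <-> in_graph H u v.
Proof.
case: G H => [X ax vx] [Y ay vy]; split=> [/= [GH HG] u v|E].
  split=> -[x [ux ->]] /=.
    by have [y [xy ->]] := GH x; exists y; split=> //; exact: farg_eq_trans ux xy.
  have [y [yx <-]] := HG x; exists y; split=> //.
  by apply: farg_eq_trans ux _; exact: farg_eq_sym.
split=> [x|y].
  have [y [? ?]] : in_graph (SFun ay vy) (ax x) (vx x).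
    by apply/E; exists x; split=> //; exact: farg_eq_refl.
  by exists y.
have [x [? ?]] : in_graph (SFun ax vx) (ay y) (vy y).
  by apply/E; exists y; split=> //; exact: farg_eq_refl.
by exists x; split=> //; exact: farg_eq_sym.
Qed.

Lemma in_graph_union (J : Type) (G : J -> sfun L) u v :
  in_graph (fg_union G) u v <-> exists j, in_graph (G j) u v.
Proof.
split=> [[[j x] H]|[j [x H]]]; first by exists j, x.
by exists (existT _ j x).
Qed.

End FunctionGraphs.

(** * Unfolding the transfinite recursions into stages *)

Lemma ord_cases (x : Ord) :
  [\/ x = ozero, exists y, x = osucc y | is_limit x].
Proof.
case: (pselect (x = ozero)) => [|x0]; first by constructor 1.
by case: (pselect (exists y, x = osucc y)) => ?; [constructor 2|constructor 3].
Qed.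

Lemma osucc_lt_limit (x y : Ord) : is_limit x -> y < x -> osucc y < x.
Proof.
move=> [_ nS] yx; case: (ltgtP (osucc y) x) => // [xS|Sx].
  by move: xS; rewrite olt_succP leNgt yx.
by case: nS; exists y.
Qed.

Section Stages.
Context d (O : completeHeytingType d) (L : signature O) (mu : Ord).

Lemma in_graph_F alpha (M : pstruct L) g (a : idx g -> M) u v :
  in_graph (F mu alpha a) u v <->
  in_graph (I_fun a) u v \/
  exists2 gamma, gamma < alpha &
    in_graph (new_fun mu gamma (F mu gamma) a) u v.
Proof.
elim/(well_founded_ind olt_wf): alpha => alpha IH.
have [->|[beta aE]|lim] := ord_cases alpha.
- rewrite /F ord_rec0; split; first by left.
  by case=> // -[gamma]; rewrite ltNge ole0x.
- subst alpha; rewrite {1}/F ord_recS -/(F mu beta) in_graph_union.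
  split=> [[[|]]|].
  + case/(IH _ (olt_succ _)); [by left|case=> gamma gb H; right].
    by exists gamma => //; apply: lt_trans gb (olt_succ _).
  + by right; exists beta => //; exact: olt_succ.
  case=> [Iu|[gamma]]; first by exists true; apply/(IH _ (olt_succ _)); left.
  rewrite olt_succP le_eqVlt => /orP[/eqP ->|gb] H; first by exists false.
  by exists true; apply/(IH _ (olt_succ _)); right; exists gamma.
- rewrite {1}/F ord_rec_lim // in_graph_union; split=> [[[beta ba] /= ]|].
    rewrite -/(F mu beta) => /(IH _ ba)[]; first by left.
    by case=> gamma gb H; right; exists gamma => //; exact: lt_trans gb ba.
  case=> [Iu|[gamma ga H]].
    have a0 : ozero < alpha.
      by rewrite lt_neqAle ole0x andbT; apply/eqP => /esym; case: lim.
    by exists (exist _ ozero a0); apply/(IH _ a0); left.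
  (* Arguments of stage gamma first occur in the function of index gamma + 1, which is still below
     the limit. *)
  have sa := osucc_lt_limit lim ga.
  exists (exist _ (osucc gamma) sa); apply/(IH _ sa); right.
  by exists gamma => //; exact: olt_succ.
Qed.

(** An argument reveals its piece of the union: atoms lie in [I_fun], and an argument that is a
    function carries its stage as second component. Equal unions therefore have equal pieces. *)
Lemma sfun_eq_F alpha (M N : pstruct L) g h (a : idx g -> M) (b : idx h -> N) :
  sfun_eq (F mu alpha a) (F mu alpha b) <->
  sfun_eq (I_fun a) (I_fun b) /\
  forall gamma : Ord, gamma < alpha ->
    sfun_eq (new_fun mu gamma (F mu gamma) a)
            (new_fun mu gamma (F mu gamma) b).
Proof.
split=> [/sfun_eqP E|[/sfun_eqP EI En]].
  split=> [|gamma ga]; apply/sfun_eqP.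
    case=> [x|G beta] v; last by split=> -[y [[]]].
    have := E (ArgAtom x) v; rewrite !in_graph_F => -[E1 E2].
    by split=> H; [have := E1 (or_introl H)|have := E2 (or_introl H)];
      case=> // -[? _ [? []]].
  case=> [x|G beta] v; first by split=> -[y []].
  have := E (ArgFun G beta) v; rewrite !in_graph_F => -[E1 E2].
  have ga' (K : pstruct L) k (c : idx k -> K) :
      in_graph (new_fun mu gamma (F mu gamma) c) (ArgFun G beta) v ->
      beta = gamma by case=> ? [[]].
  by split=> H; have bg := ga' _ _ _ H; subst beta;
    [have := E1 (or_intror (ex_intro2 _ _ gamma ga H))
    |have := E2 (or_intror (ex_intro2 _ _ gamma ga H))];
    case=> [[? []]|[beta _ H']] //; have [? [[_ e] _]] := H'; subst beta.
apply/sfun_eqP => u v; rewrite !in_graph_F.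
by split=> -[/EI ?|[gamma ga H]]; [left|right|left|right] => //;
  exists gamma => //; have /sfun_eqP E := En _ ga; apply/E.
Qed.

Lemma Q_stages alpha p (M N : pstruct L) (h : piso M N) :
  Q mu alpha p h <-> forall gamma : Ord, gamma < alpha ->
    forth mu (Q mu gamma) p h /\ back mu (Q mu gamma) p h.
Proof.
elim/(well_founded_ind olt_wf): alpha => alpha IH.
have [->|[beta aE]|lim] := ord_cases alpha.
- by rewrite /Q ord_rec0; split=> // _ gamma; rewrite ltNge ole0x.
- subst alpha; rewrite {1}/Q ord_recS -/(Q mu beta); split=> [[Qb fo ba] gamma|H].
    rewrite olt_succP le_eqVlt => /orP[/eqP -> //|].
    by move/(IH _ (olt_succ _)) : Qb; apply.
  have [fo ba] := H _ (olt_succ beta); split=> //.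
  by apply/(IH _ (olt_succ _)) => gamma gb; apply: H; apply: lt_trans gb (olt_succ _).
- rewrite {1}/Q ord_rec_lim //; split=> [H gamma ga|H [beta ba] /=].
    have sa := osucc_lt_limit lim ga.
    have /(IH _ sa) := H (exist _ (osucc gamma) sa); apply; exact: olt_succ.
  by apply/(IH _ ba) => gamma gb; apply: H; apply: lt_trans gb ba.
Qed.

End Stages.

(** * Partial isomorphisms and their inverses *)

Section PartialIsomorphisms.
Context d (O : completeHeytingType d) (L : signature O).
Implicit Types (M N : pstruct L).

Lemma maps_res M N (h : piso M N) x y q :
  maps h x y -> maps h (res x q) (res y q).
Proof.
by case=> a [b [p [ab -> ->]]]; exists a, b, (p `&` q); rewrite !res_res.
Qed.

Lemma maps_ext M N (h : piso M N) x y : maps h x y -> ext x = ext y.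
Proof.
case=> a [b [p [ab -> ->]]]; rewrite !ext_res -!seq_valxx.
by rewrite (pi_eqv ab ab).
Qed.

Lemma maps_cat M N (h : piso M N) g e (a : idx g -> M) (b : idx g -> N)
    (x : idx e -> M) (y : idx e -> N) :
  (forall k, maps h (cat_res a x k) (cat_res b y k)) <->
  (forall i, maps h (res (a i) (text x)) (res (b i) (text y))) /\
  (forall j, maps h (x j) (y j)).
Proof.
split=> [H|[Ha Hx] k].
  split=> [i|j]; first by have := H (idx_l e i); rewrite !cat_res_l.
  by have := H (idx_r g j); rewrite !cat_res_r.
have [[i ->]|[j ->]] := idx_cat k; first by rewrite !cat_res_l.
by rewrite !cat_res_r.
Qed.

Section Inverse.
Context M N (h : piso M N).

Let graph y x := pi_graph h x y.

Let extend_inv y x : extend graph y x -> maps h x y.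
Proof. by case=> b [a [p [? ? ?]]]; exists a, b, p. Qed.

Let inv_fun b a a' : graph b a -> graph b a' -> a = a'.
Proof. exact: pi_inj. Qed.

Let inv_inj b b' a : graph b a -> graph b' a -> b = b'.
Proof. exact: pi_fun. Qed.

Let inv_eqv b0 b1 a0 a1 : graph b0 a0 -> graph b1 a1 ->
  seq_val b0 b1 = seq_val a0 a1.
Proof. by move=> ? ?; apply/esym/(@pi_eqv _ _ _ _ _ h). Qed.

Let inv_atom n (psi : uatom L n) (y : 'I_n -> N) (x : 'I_n -> M) :
  (forall i, extend graph (y i) (x i)) -> aval psi y = aval psi x.
Proof.
by move=> yx; apply/esym/(@pi_atom _ _ _ _ _ h) => i; exact/extend_inv.
Qed.

Definition piso_inv : piso N M := PIso inv_fun inv_inj inv_eqv inv_atom.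

Lemma maps_inv y x : maps piso_inv y x <-> maps h x y.
Proof. by split=> -[a [b [p [? ? ?]]]]; exists b, a, p. Qed.

End Inverse.

(** With this, the back property of a map can be derived from the forth property of its inverse. *)
Lemma piso_invK M N (h : piso M N) : piso_inv (piso_inv h) = h.
Proof. by case: h => *; congr PIso; exact: Prop_irrelevance. Qed.

Lemma sub_at_inv M N q (h h' : piso M N) :
  sub_at q h h' -> sub_at q (piso_inv h) (piso_inv h').
Proof.
move=> hh' y x /maps_inv xy yq; apply/maps_inv/hh' => //.
by rewrite (maps_ext xy).
Qed.

(** * The partial isomorphism generated by two tuples *)

Section Generated.
Context M N g (a : idx g -> M) (b : idx g -> N) (p : O).
Hypotheses (ap : uniform p a) (bp : uniform p b).
Hypothesis ab : forall x : atom_index L g,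
  aval (ai_psi x) (fun k => a (ai_f x k)) =
  aval (ai_psi x) (fun k => b (ai_f x k)).

Let graph x y := exists i, x = a i /\ y = b i.

Let eq_ab i j : seq_val (a i) (a j) = seq_val (b i) (b j).
Proof.
exact: (aval_exact ab (@AEq _ _ L 2 ord0 ord_max)
  (fun k => if k == ord0 then i else j)).
Qed.

(** Turns honest equality of sections of extent p into a statement about equality values, which
    [eq_ab] carries between a and b; the graph is then functional and injective. *)
Let full_eq (K : presheaf O) (x y : K) :
  ext x = p -> ext y = p -> (x = y) <-> p <= seq_val x y.
Proof.
move=> xp yp; split=> [<-|/le_seq_val[_ _]]; first by rewrite seq_valxx xp.
by rewrite -{1}xp -yp !res_ext.
Qed.

Let gen_fun x y y' : graph x y -> graph x y' -> y = y'.
Proof.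
move=> [i [-> ->]] [j [aij ->]]; apply/full_eq; rewrite ?(uniform_ext _ bp) //.
by rewrite -eq_ab; apply/full_eq; rewrite ?(uniform_ext _ ap).
Qed.

Let gen_inj x x' y : graph x y -> graph x' y -> x = x'.
Proof.
move=> [i [-> ->]] [j [-> bij]]; apply/full_eq; rewrite ?(uniform_ext _ ap) //.
by rewrite eq_ab; apply/full_eq; rewrite ?(uniform_ext _ bp).
Qed.

Let gen_eqv x x' y y' : graph x y -> graph x' y' -> seq_val x x' = seq_val y y'.
Proof. by move=> [i [-> ->]] [j [-> ->]]; exact: eq_ab. Qed.

(** Each section concerned is some a_i or b_i restricted to some r. By [le_aval_res] its
    contribution consists of the value at the unrestricted entries, which agrees by hypothesis, and
    of bounds by r and by extents, which agree as all entries have extent p. *)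
Let gen_atom n (psi : uatom L n) (x : 'I_n -> M) (y : 'I_n -> N) :
  (forall k, extend graph (x k) (y k)) -> aval psi x = aval psi y.
Proof.
move=> xy.
have /choice[f fP] : forall k, exists fr : idx g * O,
    x k = res (a fr.1) fr.2 /\ y k = res (b fr.1) fr.2.
  by move=> k; have [_ [_ [r [[i [-> ->]] -> ->]]]] := xy k; exists (i, r).
have -> : x = fun k => res (a (f k).1) (f k).2.
  by apply/funext => k; case: (fP k).
have -> : y = fun k => res (b (f k).1) (f k).2.
  by apply/funext => k; case: (fP k).
apply: eq_by_le => q.
rewrite !(le_aval_res psi (fun k => _ (f k).1)) (aval_exact ab psi).
have E k : ext (a (f k).1) = ext (b (f k).1).
  by rewrite (uniform_ext _ ap) (uniform_ext _ bp).
by split=> -[H ?]; split=> // k /H; rewrite E.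
Qed.

Definition piso_gen : piso M N := PIso gen_fun gen_inj gen_eqv gen_atom.

Lemma maps_gen i : maps piso_gen (a i) (b i).
Proof.
exists (a i), (b i), p; split; first by exists i.
  by rewrite -(uniform_ext i ap) res_ext.
by rewrite -(uniform_ext i bp) res_ext.
Qed.

End Generated.

End PartialIsomorphisms.

(** * Forth and back: covers, inversion and monotonicity *)

Section BackForth.
Context d (O : completeHeytingType d) (L : signature O) (mu : Ord).
Implicit Types (M N : pstruct L).

Definition forth_set (Qb : piso_class L) M N (h : piso M N) g (c : idx g -> M) :
    set O :=
  fun q => exists (h' : piso M N) (e : idx g -> N),
    [/\ Qb q M N h', sub_at q h h', uniform q e, q <= text c
      & forall i, maps h' (res (c i) q) (e i)].

(** A covering family may be enlarged to the set of all admissible triples, each of which has q_j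
    below E c; so the existence of a cover is a single inequality. *)
Lemma forthP (Qb : piso_class L) p M N (h : piso M N) :
  forth mu Qb p h <->
  forall g (c : idx g -> M), ozero < g -> g < mu -> same_ext c -> text c <= p ->
    text c <= hsup (forth_set Qb h c).
Proof.
split=> H g c g0 gmu cu cp.
  have /(H _ _ g0 gmu cu)[S [SP <-]] : forall i, ext (c i) <= p.
    by move=> i; rewrite cu.
  apply: hsup_le => _ [[[h' q] e] Sx <-]; apply: hsup_ub.
  have [Qh sub [eu eq] ec he] := SP _ _ _ Sx.
  exists h', e; split=> //; first by rewrite -eq.
  by have [i] := idx_inhabited g0; rewrite /= -eq -(eu i).
exists [set x | [/\ Qb x.1.2 M N x.1.1, sub_at x.1.2 h x.1.1, uniform x.1.2 x.2,
  x.1.2 <= text c & forall i, maps x.1.1 (res (c i) x.1.2) (x.2 i)]]%classic.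
split=> [h' q e /= [Qh sub eu qc he]|].
  split=> //; first by split; [exact: uniform_same_ext eu|exact: uniform_text eu].
  by move=> i; rewrite (uniform_ext i eu).
apply: le_anti; apply/andP; split.
  by apply: hsup_le => _ [[[h' q] e] [? ? ? ? ?] <-].
have ctp : text c <= p.
  by have [i] := idx_inhabited g0; rewrite -(cu i).
apply: le_trans (H _ c g0 gmu cu ctp) _; apply: hsup_le => q [h' [e he]].
by apply: hsup_ub; exists (h', q, e).
Qed.

Definition inv_closed (Qb : piso_class L) :=
  forall q M N (h : piso M N), Qb q M N h -> Qb q N M (piso_inv h).

(** Inverting every h_j, with q_j and the tuples kept, turns a cover for Forth into one for Back. *)
Lemma back_inv (Qb : piso_class L) p M N (h : piso M N) :
  inv_closed Qb -> forth mu Qb p h -> back mu Qb p (piso_inv h).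
Proof.
move=> Qi fo g c g0 gmu cu cp; have [S [SP Sc]] := fo g c g0 gmu cu cp.
exists [set (piso_inv x.1.1, x.1.2, x.2) | x in S]%classic; split; last first.
  rewrite -Sc; congr hsup; apply/seteqP; split=> q.
    by case=> _ [x Sx <-] <-; exists x.
  by case=> x Sx <-; exists (piso_inv x.1.1, x.1.2, x.2) => //; exists x.
move=> _ _ _ [[[h' q] e] /SP[Qh sub eu ec he] [<- <- <-]]; split=> //=.
- exact: Qi.
- exact: sub_at_inv.
- by move=> i; apply/maps_inv.
Qed.

Lemma forth_inv (Qb : piso_class L) p M N (h : piso M N) :
  inv_closed Qb -> back mu Qb p h -> forth mu Qb p (piso_inv h).
Proof.
move=> Qi ba g c g0 gmu cu cp; have [S [SP Sc]] := ba g c g0 gmu cu cp.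
exists [set (piso_inv x.1.1, x.1.2, x.2) | x in S]%classic; split; last first.
  rewrite -Sc; congr hsup; apply/seteqP; split=> q.
    by case=> _ [x Sx <-] <-; exists x.
  by case=> x Sx <-; exists (piso_inv x.1.1, x.1.2, x.2) => //; exists x.
move=> _ _ _ [[[h' q] e] /SP[Qh sub eu ec he] [<- <- <-]]; split=> //=.
- exact: Qi.
- exact: sub_at_inv.
- by move=> i; apply/maps_inv.
Qed.

Lemma Q_inv alpha : inv_closed (Q mu alpha).
Proof.
elim/(well_founded_ind olt_wf): alpha => alpha IH q M N h /Q_stages H.
apply/Q_stages => gamma ga; have [fo ba] := H _ ga.
by split; [apply: forth_inv|apply: back_inv] => //; exact: IH.
Qed.

(** The parameter only bounds the extents of the tuples to be answered, so a smaller one asks for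
    less. *)
Lemma Q_le alpha p q M N (h : piso M N) :
  q <= p -> Q mu alpha p h -> Q mu alpha q h.
Proof.
move=> qp /Q_stages H; apply/Q_stages => gamma ga; have [fo ba] := H _ ga.
by split=> g c g0 gmu cu cq; [apply: fo|apply: ba] => // i;
  exact: le_trans (cq i) qp.
Qed.

End BackForth.

(** * Equality of the functions F against back-and-forth *)

Section Comparison.
Context d (O : completeHeytingType d) (L : signature O) (mu : Ord).
Implicit Types (M N K : pstruct L).

Definition bf_iso alpha p M N g (a : idx g -> M) (b : idx g -> N) :=
  exists h : piso M N, (forall i, maps h (a i) (b i)) /\ Q mu alpha p h.

Lemma bf_iso_tres alpha p q M N g (a : idx g -> M) (b : idx g -> N) :
  q <= p -> bf_iso alpha p a b -> bf_iso alpha q (tres a q) (tres b q).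
Proof.
move=> qp [h [hab Qh]]; exists h; split; last exact: Q_le Qh.
by move=> i; exact: maps_res.
Qed.

(* A pair in the graph of I_a, read without reference to the index type, so that
   it can be transported along an equality of arguments. *)
Let reading M g (a : idx g -> M) (u : atom_arg L) (v : O) :=
  exists f : 'I_(aa_n u) -> idx g,
    (forall k, sval (f k) = aa_f u k) /\ v = aval (aa_psi u) (fun k => a (f k)).

(** Equal arguments are equal dependent records with the number of variables as a field; rewriting
    inside [reading] avoids inverting that equality. The lengths g and h are not yet known to
    agree. *)
Lemma I_fun_reading M N g h (a : idx g -> M) (b : idx h -> N) (x : atom_index L g) :
  sfun_eq (I_fun a) (I_fun b) ->
  exists f : 'I_(ai_n x) -> idx h, (forall k, sval (f k) = sval (ai_f x k)) /\
    aval (ai_psi x) (fun k => a (ai_f x k)) = aval (ai_psi x) (fun k => b (f k)).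
Proof.
move=> /= [/(_ x)[y [xy ->]] _].
have : reading b (AtomArg (ai_psi y) (fun k => sval (ai_f y k)))
    (aval (ai_psi y) (fun k => b (ai_f y k))) by exists (ai_f y).
by rewrite -xy.
Qed.

Lemma I_fun_eqP M N g (a : idx g -> M) (b : idx g -> N) :
  sfun_eq (I_fun a) (I_fun b) <-> forall x : atom_index L g,
    aval (ai_psi x) (fun k => a (ai_f x k)) =
    aval (ai_psi x) (fun k => b (ai_f x k)).
Proof.
split=> [E x|E]; last by split=> x; exists x.
have [f [fx ->]] := I_fun_reading x E.
by congr aval; apply/funext => k; congr b; exact: idx_val_inj.
Qed.

Lemma I_fun_ext M N g h (a : idx g -> M) (b : idx h -> N) (i : idx g) :
  sfun_eq (I_fun a) (I_fun b) ->
  exists j : idx h, sval j = sval i /\ ext (a i) = ext (b j).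
Proof.
move=> E; have ex (k : 'I_1) : occurs k (@AEq _ _ L 1 ord0 ord0).
  by left; exact: ord1.
have [f [fx]] := I_fun_reading (AtomIndex ex (fun=> i)) E.
by rewrite /= !seq_valxx => ->; exists (f ord0).
Qed.

Lemma I_fun_length M N g h (a : idx g -> M) (b : idx h -> N) :
  sfun_eq (I_fun a) (I_fun b) -> g = h.
Proof.
(* If g < h, then g itself is a position of b, and its formula v_0 = v_0 would have to come from a
   position g of a. *)
move=> E; case: (ltgtP g h) => // [gh|hg].
  have [j [jg _]] := I_fun_ext (exist (fun i => is_true (i < h)) g gh) (sfun_eq_sym E).
  by have := svalP j; rewrite jg ltxx.
have [j [jh _]] := I_fun_ext (exist (fun i => is_true (i < g)) h hg) E.
by have := svalP j; rewrite jh ltxx.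
Qed.

Lemma I_fun_text M N g (a : idx g -> M) (b : idx g -> N) :
  sfun_eq (I_fun a) (I_fun b) -> text a = text b.
Proof.
move=> E; suff ab : (fun i => ext (a i)) = (fun i => ext (b i)) by rewrite /text ab.
apply/funext => i; have [j [/idx_val_inj ji ->]] := I_fun_ext i E.
by rewrite ji.
Qed.

(** This is [new_val] with K, s, t as free parameters: the type [new_index a] depends on a, so
    values over M and over N could not otherwise be compared. *)
Definition witness_val (Fa : fun_family L) M g (a : idx g -> M)
    K e (s : idx g -> K) (t : idx e -> K) : O :=
  hsup [set q | exists c : idx e -> M,
    [/\ same_ext c, text c <= text t,
        sfun_eq (Fa _ _ (tres (cat_res s t) (text c))) (Fa _ _ (cat_res a c))
      & q = text c]]%classic.

(** * The passage from stage gamma to the next *)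

Section Step.
Variable gamma : Ord.
Hypothesis IH : forall M N g (a : idx g -> M) (b : idx g -> N) p,
  uniform p a -> uniform p b ->
  sfun_eq (F mu gamma a) (F mu gamma b) <-> bf_iso gamma p a b.

(** The induction hypothesis turns the equality into a partial isomorphism, which can be restricted,
    and back. Nonempty tuples are taken because an empty one keeps the extent \top. *)
Lemma F_tres M N g (a : idx g -> M) (b : idx g -> N) p q :
  ozero < g -> uniform p a -> uniform p b -> q <= p ->
  sfun_eq (F mu gamma a) (F mu gamma b) ->
  sfun_eq (F mu gamma (tres a q)) (F mu gamma (tres b q)).
Proof.
move=> g0 ap bp qp /(IH ap bp) ab; have aq := uniform_tres g0 ap qp.
by apply/(IH aq (uniform_tres g0 bp qp)); exact: bf_iso_tres ab.
Qed.

(** Forth covers E c, for a witness c over M, by extents q of tuples x of N. Each x is a witness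
    over N: the function of st restricted to q equals that of ac restricted to q by [F_tres], and
    the latter equals that of bx by the induction hypothesis applied to h'. *)
Lemma witness_val_le M N g (a : idx g -> M) (b : idx g -> N) p (h : piso M N)
    K e (s : idx g -> K) (t : idx e -> K) :
  uniform p a -> uniform p b -> (forall i, maps h (a i) (b i)) ->
  forth mu (Q mu gamma) p h ->
  ozero < e -> e < mu -> same_ext s -> same_ext t ->
  text t <= p -> text t <= text s ->
  witness_val (F mu gamma) a s t <= witness_val (F mu gamma) b s t.
Proof.
move=> ap bp hab /forthP fo e0 emu su tu tp ts.
have ge0 := oadd_gt0 g e0.
have stu := uniform_cat e0 (same_ext_uniform su) (same_ext_uniform tu) ts.
apply: hsup_le => _ [c [cu ct Eac ->]].
have cp := le_trans ct tp.
have acu := uniform_cat e0 ap (same_ext_uniform cu) cp.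
apply: le_trans (fo _ c e0 emu cu cp) _.
apply: hsup_le => q [h' [x [Qh' sub xq qc h'cx]]].
have qt := le_trans qc ct; have qp := le_trans qt tp.
apply: hsup_ub; exists x; rewrite (uniform_text xq); split=> //.
  exact: uniform_same_ext xq.
have cq := uniform_tres e0 (same_ext_uniform cu) qc.
apply: (@sfun_eq_trans _ _ _ _ (F mu gamma (tres (cat_res a c) q))).
  rewrite -(tres_tres (cat_res s t) qc); apply: F_tres acu qc Eac => //.
  exact: uniform_tres ge0 stu ct.
apply/(IH (uniform_tres ge0 acu qc) (uniform_cat e0 bp xq qp)).
exists h'; split=> //; rewrite (tres_cat _ e0 cu qc); apply/maps_cat; split=> // i.
(* On the a-part, h' agrees with h, since the restricted entries have extent exactly q. *)
rewrite (uniform_text cq) (uniform_text xq); apply: sub; first exact: maps_res.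
by rewrite ext_res_le // (uniform_ext i ap).
Qed.

(** The maps h' come from the induction hypothesis and are only known to match a with b and c with
    x; they extend h because the graph of h has no other pairs than (a_i, b_i). *)
Lemma forth_of_new M N g (a : idx g -> M) (b : idx g -> N) p (h : piso M N) :
  uniform p a -> uniform p b ->
  (forall x y, pi_graph h x y -> exists i, x = a i /\ y = b i) ->
  sfun_eq (new_fun mu gamma (F mu gamma) a) (new_fun mu gamma (F mu gamma) b) ->
  forth mu (Q mu gamma) p h.
Proof.
move=> ap bp hab [/= E _]; apply/forthP => e c e0 emu cu cp.
have ge0 := oadd_gt0 g e0; have cu' := same_ext_uniform cu.
have acu := uniform_cat e0 ap cu' cp.
have ca : text c <= text a `&` text a by rewrite meetxx (uniform_text ap).
(* The argument is built from K = M, s = a, t = c, for which c is its own witness. Over N the same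
   argument may be presented by other data y = (K, s, t). *)
have [y [[Est _] Ev]] := E (NewIndex e0 emu (uniform_same_ext ap) cu ca).
have {E Ev} /le_trans-> // : text c <= witness_val (F mu gamma) b (ni_s y) (ni_t y).
  rewrite -[leRHS]Ev; apply: hsup_ub; exists c; split=> //=.
  by rewrite (tres_id acu); exact: sfun_eq_refl.
case: y Est => K s e' t e'0 e'mu su tu /= tbs Est.
have EI := (sfun_eq_F _ _ _ _).1 Est.
(* Only the total lengths are compared; cancelling g on the left identifies the lengths of t and
   c. *)
have /oadd_inj ee' := I_fun_length EI.1; subst e'.
move: tbs; rewrite lexI => /andP[_ ts].
have stu := uniform_cat e0 (same_ext_uniform su) (same_ext_uniform tu) ts.
have tc : text t = text c.
  by rewrite -(uniform_text stu) -(uniform_text acu) (I_fun_text EI.1).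
rewrite tc in stu.
apply: hsup_le => _ [x [xu xt Ebx ->]]; rewrite tc in xt; apply: hsup_ub.
have xu' := same_ext_uniform xu; have xp := le_trans xt cp.
have bxu := uniform_cat e0 bp xu' xp.
have : sfun_eq (F mu gamma (tres (cat_res a c) (text x))) (F mu gamma (cat_res b x)).
  exact: sfun_eq_trans (F_tres ge0 acu stu xt Est) Ebx.
case/(IH (uniform_tres ge0 acu xt) bxu) => h' [].
rewrite (tres_cat _ e0 cu xt) => /maps_cat[h'ab h'cx] Qh'.
exists h', x; split=> // x' y' [_ [_ [r [/hab[i [-> ->]] -> ->]]]] xr.
have := h'ab i; rewrite (uniform_text (uniform_tres e0 cu' xt)).
(* The element r need not lie below p, but the meet of p and r is E x, so on sections of extent p
   both restrictions agree. *)
have rE (P : presheaf O) (z : P) : ext z = p -> res z (text x) = res z r.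
  move=> zp; rewrite -xr ext_res (uniform_ext i ap) -zp -res_res.
  by rewrite res_ext.
by rewrite !rE ?(uniform_ext i ap) ?(uniform_ext i bp).
Qed.

End Step.

Lemma F_eqP alpha M N g (a : idx g -> M) (b : idx g -> N) p :
  uniform p a -> uniform p b ->
  sfun_eq (F mu alpha a) (F mu alpha b) <-> bf_iso alpha p a b.
Proof.
elim/(well_founded_ind olt_wf): alpha M N g a b p => alpha IHa M N g a b p ap bp.
have IH gamma (ga : gamma < alpha) : forall M N g (a : idx g -> M) (b : idx g -> N) p,
    uniform p a -> uniform p b ->
    sfun_eq (F mu gamma a) (F mu gamma b) <-> bf_iso gamma p a b.
  by move=> *; exact: IHa.
rewrite sfun_eq_F; split=> [[/I_fun_eqP EI En]|[h [hab /Q_stages Qh]]].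
  exists (piso_gen ap bp EI); split=> [i|]; first exact: maps_gen.
  apply/Q_stages => gamma ga; split.
    by apply: (forth_of_new (IH _ ga) ap bp _ (En _ ga)) => x y [i [-> ->]]; exists i.
  (* Back is Forth for the inverse, whose graph consists of the pairs (b_i, a_i). *)
  rewrite -[piso_gen _ _ _]piso_invK; apply: back_inv; first exact: Q_inv.
  apply: (forth_of_new (IH _ ga) bp ap _ (sfun_eq_sym (En _ ga))) => y x.
  by case=> i [-> ->]; exists i.
split=> [|gamma ga].
  apply/I_fun_eqP => x; apply: (@pi_atom _ _ _ _ _ h) => k; exact: hab.
have [fo ba] := Qh _ ga; have foi := forth_inv (@Q_inv _ _ _ _ _) ba.
have iab i : maps (piso_inv h) (b i) (a i) by exact/maps_inv.
have E e K (s : idx g -> K) (t : idx e -> K) :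
    ozero < e -> e < mu -> same_ext s -> same_ext t ->
    text t <= p `&` text s ->
    witness_val (F mu gamma) a s t = witness_val (F mu gamma) b s t.
  move=> e0 emu su tu; rewrite lexI => /andP[tp ts]; apply: le_anti.
  apply/andP; split.
    exact: (witness_val_le (IH _ ga) ap bp hab fo).
  exact: (witness_val_le (IH _ ga) bp ap iab foi).
(* As a and b have the same extent, data (K, s, t) admissible for one are admissible for the other,
   and each new argument is matched with itself. *)
split=> -[K s e t e0 emu su tu tps].
  have tps' := tps; rewrite (uniform_text ap) in tps'.
  have tbs : text t <= text b `&` text s by rewrite (uniform_text bp).
  exists (NewIndex e0 emu su tu tbs); split; last exact: E.
  by split=> //; exact: sfun_eq_refl.
have tps' := tps; rewrite (uniform_text bp) in tps'.
have tas : text t <= text a `&` text s by rewrite (uniform_text ap).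
exists (NewIndex e0 emu su tu tas); split; last exact: E.
by split=> //; exact: sfun_eq_refl.
Qed.

End Comparison.

Theorem proposition5p9 (d : Order.disp_t) (O : completeHeytingType d)
    (L : signature O) (mu : Ord) (mu_card : is_cardinal mu)
    (M : pstruct L) (g : Ord) (a : idx g -> M) (alpha : Ord)
    (N : pstruct L) (b : idx g -> N) :
  let p := text a `&` text b in
  sfun_eq (F mu alpha (tres a p)) (F mu alpha (tres b p)) <->
  exists h : piso M N,
    (forall i : idx g, maps h (res (a i) p) (res (b i) p)) /\ Q mu alpha p h.
Proof.
move=> p.
have tresp (K : presheaf O) (x : idx g -> K) : p <= text x -> uniform p (tres x p).
  move=> px; have xp i : ext (tres x p i) = p.
    by rewrite ext_res_le //; exact: (le_text _ _).1.
  case: (pselect (inhabited (idx g))) => [gi|g0]; first exact: uniform_inhabited.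
  (* For empty tuples p is \top, as [uniform] demands. *)
  have top (K' : presheaf O) (y : idx g -> K') : text y = \top.
    apply: le_anti; rewrite lex1 /=; apply/le_text => i.
    by case: g0; constructor.
  by split=> //; rewrite /p !top meetxx.
exact: F_eqP (tresp _ _ (leIl _ _)) (tresp _ _ (leIr _ _)).
Qed.
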